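(* Let $A,B\in\mathcal{L}(\mathcal{H})$ be indefinite selfadjoint operators, and let $\beta\in\mathbb{R}$ and $(a,b)\in\mathcal{H}\times\mathcal{H}$. Then $x\in\mathcal{Z}(\beta,a,b)$ if and only if there exists $\lambda\in I_\geq(A,B)$ satisfying $$\begin{cases}(A+\lambda B)x=-(a+\lambda b),\\ \langle Bx,x\rangle+2\operatorname{Re}\langle b,x\rangle=\beta.\end{cases}$$
   Context: $\mathcal{H}$ is a complex separable Hilbert space with inner product $\langle\cdot,\cdot\rangle$; $\mathcal{L}(\mathcal{H})$ is the algebra of bounded linear operators on $\mathcal{H}$. A selfadjoint operator is indefinite if it is neither positive semidefinite nor negative semidefinite. Set $f(x)=\langle Ax,x\rangle+2\operatorname{Re}\langle a,x\rangle$ and $g(x)=\langle Bx,x\rangle+2\operatorname{Re}\langle b,x\rangle$ for $x\in\mathcal{H}$. $\mathcal{Z}(\beta,a,b)$ is the set of solutions (global minimizers) of: minimize $f(x)$ subject to $g(x)=\beta$. $I_\geq(A,B)=\{\lambda\in\mathbb{R}: A+\lambda B\text{ is positive semidefinite}\}$. *)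

(* Defs.v *)
From HB Require Import structures.
From mathcomp Require Import all_boot all_order all_algebra.
From mathcomp Require Import complex.
From mathcomp Require Import boolp classical_sets functions cardinality reals.
From mathcomp Require Import topology normedtype.

Set Implicit Arguments.
Unset Strict Implicit.
Unset Printing Implicit Defensive.

Import Order.TTheory GRing.Theory Num.Theory.
Import numFieldNormedType.Exports.

Local Open Scope classical_set_scope.
Local Open Scope ring_scope.

Definition separable (T : topologicalType) : Prop :=
  exists2 D : set T, countable D & dense D.

(* With H complete for its norm, this makes (H, dot) a Hilbert space.        *)
(* [dot] is linear in its first and conjugate-linear in its second argument. *)
Definition norm_induced (R : realType) (H : normedModType R[i])
  (dot : {dot H for Num.conj}) : Prop := forall x : H, `|x| ^+ 2 = dot x x.

(* For linear T this is boundedness as an operator, see [linear_boundedP]. *)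
Definition bounded_operator (R : realType) (H : normedModType R[i])
  (T : H -> H) : Prop := bounded_near T (nbhs (0 : H)).

Section Operators.
Variables (R : realType) (H : lmodType R[i]) (dot : {dot H for Num.conj}).
Implicit Types (T A B : H -> H) (a b x : H).

Definition selfadjoint T : Prop := forall x y, dot (T x) y = dot x (T y).

(* In R[i], [0 <= z] means that z is real and nonnegative. *)
Definition possemidef T : Prop := forall x, 0 <= dot (T x) x.

Definition negsemidef T : Prop := forall x, dot (T x) x <= 0.

Definition indefinite T : Prop := ~ possemidef T /\ ~ negsemidef T.

(* The first [complex.Re] only changes the type: [dot (T x) x] is real when *)
(* T is selfadjoint, see [quadE].                                           *)
Definition quad T a x : R :=
  complex.Re (dot (T x) x) + 2 * complex.Re (dot a x).

Lemma quadE T a x : selfadjoint T ->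
  ((quad T a x)%:C)%C = dot (T x) x + 2 * 'Re (dot a x).
Proof.
move=> sT; rewrite /quad rmorphD rmorphM /= rmorph_nat.
have dotC u v : dot u v = (dot v u)^*.
  by have := @hermitian_subproof _ _ _ _ dot u v; rewrite expr0 mul1r.
have /CrealP Rd : (dot (T x) x)^* = dot (T x) x by rewrite -dotC sT.
have ReE (z : R[i]) : ((complex.Re z)%:C)%C = 'Re z by rewrite complexRe.
by rewrite !ReE (Creal_ReP _ Rd).
Qed.

(* The set Z(beta, a, b) of global minimizers. *)
Definition minimizers A B (beta : R) a b : set H :=
  [set x | quad B b x = beta /\
           forall y, quad B b y = beta -> quad A a x <= quad A a y].

Definition I_ge A B : set R := [set l | possemidef (A \+ l%:C%C \*: B)].

End Operators.

(* Main.v *)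
Require Import Defs.
From HB Require Import structures.
From mathcomp Require Import all_boot all_order all_algebra.
From mathcomp Require Import complex ring lra.
From mathcomp Require Import boolp classical_sets functions cardinality reals.
From mathcomp Require Import topology normedtype.

Set Implicit Arguments.
Unset Strict Implicit.
Unset Printing Implicit Defensive.

Import Order.TTheory GRing.Theory Num.Theory.
Import numFieldNormedType.Exports.

Local Open Scope classical_set_scope.
Local Open Scope ring_scope.

(** The theorem is an S-lemma with equality followed by the characterization
of the minimizers of a convex quadratic function. Write [f] and [g] for the
objective and the constraint function.

If [f >= alpha] on the set [g = beta] and [B] is indefinite, then there is a
multiplier [l] with [f - alpha + l * (g - beta) >= 0] everywhere
([S_lemma_equality]). The points with [g > beta] bound [l] from below, those
with [g < beta] bound it from above, and those with [g = beta] impose nothing,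
so [l] exists as soon as each lower bound is at most each upper bound
([cross_ge0]). That comparison involves only two points, so it takes place on
the real line through them, where [f] and [g] are quadratic polynomials in one
variable and [g - beta] has two roots separated in the sense of the projective
line by the two points; a suitable nonnegative combination of the values of
[f - alpha] at these roots is the inequality wanted
([quadratic_cross_ge0]). One root is at infinity when the
quadratic form of [B] vanishes on the direction of the line; moving one of the
points a little avoids this, and the inequality passes to the limit.

Applied with [alpha = f x] at a minimizer [x], the multiplier makes [x] an
unconstrained global minimizer of the quadratic function [f + l * g], whose
operator is [A + l B] and whose linear part is [a + l b]. Expanding along
lines through [x], this means that [A + l B] is positive semidefinite and that
the gradient [(A + l B) x + (a + l b)] vanishes ([quad_minP]). The converse is
the same equivalence read backwards, since [f + l * g] and [f] differ by a
constant on the feasible set. *)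

(** * Real quadratic polynomials *)

Lemma quadratic_neg_near0 (R : realFieldType) (c0 c1 c2 : R) : c0 < 0 ->
  exists2 d, 0 < d & forall s, 0 < s < d -> c0 + s * c1 + s ^+ 2 * c2 < 0.
Proof.
move=> c0_lt0; pose K := `|c1| + `|c2| + 1.
have K_gt0 : 0 < K by rewrite ltr_wpDl // addr_ge0.
(* For [0 < s < 1], the increment is at most [s * (|c1| + |c2|)]. *)
exists (Num.min 1 (- c0 / K)); first by rewrite lt_min ltr01 divr_gt0 ?oppr_gt0.
move=> s; rewrite lt_min => /and3P[s_gt0 s_lt1]; rewrite ltr_pdivlMr // => sK.
have c1_le := ler_norm c1; have c2_le := ler_norm c2.
have c2_ge0 := normr_ge0 c2.
have : s * c1 <= s * `|c1| by rewrite ler_wpM2l // ltW.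
have : s ^+ 2 * c2 <= s * `|c2|.
  by rewrite expr2 -mulrA ler_wpM2l ?(ltW s_gt0) //; nra.
by rewrite /K in sK; lra.
Qed.

Lemma quadratic0_ge0 (R : realFieldType) (c1 c2 : R) :
  (forall s, 0 <= s * c1 + s ^+ 2 * c2) -> c1 = 0 /\ 0 <= c2.
Proof.
move=> c_ge0; split; last by have := c_ge0 1; have := c_ge0 (- 1); nra.
apply/eqP; apply/negPn/negP => c1_neq0.
have c2_ge0 : 0 <= c2 by have := c_ge0 1; have := c_ge0 (- 1); nra.
(* Dividing by [c2 + 1] rather than [c2] allows for [c2 = 0]. *)
have := c_ge0 (- c1 / (c2 + 1)).
have -> : - c1 / (c2 + 1) * c1 + (- c1 / (c2 + 1)) ^+ 2 * c2
  = - ((c1 / (c2 + 1)) ^+ 2) by field; lra.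
by rewrite oppr_ge0 leNgt exprn_even_gt0 // mulf_neq0 ?invr_eq0 //; lra.
Qed.

Lemma quadratic_gt (R : realFieldType) (c p r : R) : 0 < p ->
  exists s, c < s * r + s ^+ 2 * p.
Proof.
move=> p_gt0; pose s := (`|r| + `|c|) / p + 1; exists s.
have sp : s * p = `|r| + `|c| + p by rewrite /s; field; rewrite gt_eqF.
have s_ge1 : 1 <= s by rewrite lerDr divr_ge0 ?addr_ge0 // ltW.
have -> : s * r + s ^+ 2 * p = s * (r + s * p) by ring.
rewrite sp; have := ler_norm (- r); rewrite normrN => r_ge.
have c_le := ler_norm c.
have c_ge0 := normr_ge0 c.
apply: (@lt_le_trans _ _ (r + (`|r| + `|c| + p))); first by lra.
by rewrite ler_peMl //; lra.
Qed.

(** Let [f] and [g] be the polynomials in [s] with coefficients [fi] and [gi].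
With [t = s / (1 - s)], [g] becomes, up to the square [(1 + t) ^+ 2], a
quadratic in [t] whose extreme coefficients [g 0 > 0] and [g 1 < 0] have
opposite signs, hence with roots of opposite signs and of product [g 0 / g 1].
Weighting the transform of [f] at each root by the absolute value of the other
root cancels its middle coefficient. *)
Lemma quadratic_cross_ge0 (R : rcfType) (f0 f1 f2 g0 g1 g2 : R) :
    0 < g0 -> g0 + g1 + g2 < 0 -> g2 != 0 ->
    (forall s, g0 + s * g1 + s ^+ 2 * g2 = 0 ->
       0 <= f0 + s * f1 + s ^+ 2 * f2) ->
  0 <= f0 * - (g0 + g1 + g2) + (f0 + f1 + f2) * g0.
Proof.
move=> g0_gt0 g_lt0 g2_neq0 f_ge0.
set N := - (g0 + g1 + g2); have N_gt0 : 0 < N by rewrite oppr_gt0.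
pose M := 2 * g0 + g1; pose D := M ^+ 2 + 4 * g0 * N.
have root_ge0 t : g0 + t * M - t ^+ 2 * N = 0 ->
    0 <= f0 + t * (2 * f0 + f1) + t ^+ 2 * (f0 + f1 + f2).
  (* [t = -1] is [s] at infinity, a root only when [g2 = 0]. *)
  move=> t_root; have t1_neq0 : 1 + t != 0.
    apply: contra_neq g2_neq0 => t1; have tE : t = - 1 by lra.
    by move: t_root; rewrite tE /N /M; lra.
  have -> : f0 + t * (2 * f0 + f1) + t ^+ 2 * (f0 + f1 + f2) =
      (1 + t) ^+ 2 * (f0 + t / (1 + t) * f1 + (t / (1 + t)) ^+ 2 * f2).
    by field.
  rewrite mulr_ge0 ?sqr_ge0 // f_ge0 //.
  apply: (mulfI (expf_neq0 2 t1_neq0)); rewrite mulr0 -[RHS]t_root /N /M.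
  by field.
have D_ge0 : 0 <= D by rewrite /D; have := sqr_ge0 M; nra.
pose d := Num.sqrt D; have dd : d ^+ 2 = M ^+ 2 + 4 * g0 * N := sqr_sqrtr D_ge0.
have d_gt0 : 0 < d by rewrite sqrtr_gt0 /D; have := sqr_ge0 M; nra.
have M_lt : `|M| < d.
  rewrite -[d]ger0_norm ?(ltW d_gt0) // -ltr_sqr ?nnegrE //.
  rewrite !real_normK ?num_real //.
  by rewrite dd; nra.
move: M_lt; rewrite ltr_norml => /andP[Md dM].
have N_neq0 : N != 0 by rewrite gt_eqF.
clearbody d; clear D D_ge0; clearbody M N.
have rootP e : e ^+ 2 = d ^+ 2 ->
    0 <= 4 * N ^+ 2 * f0 + 2 * N * (M + e) * (2 * f0 + f1)
       + (M + e) ^+ 2 * (f0 + f1 + f2).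
  move=> ee; have := root_ge0 ((M + e) / (2 * N)).
  have -> : g0 + (M + e) / (2 * N) * M - ((M + e) / (2 * N)) ^+ 2 * N
    = (M ^+ 2 + 4 * g0 * N - e ^+ 2) / (4 * N) by field.
  rewrite ee dd subrr mul0r => /(_ erefl).
  have -> : f0 + (M + e) / (2 * N) * (2 * f0 + f1)
       + ((M + e) / (2 * N)) ^+ 2 * (f0 + f1 + f2)
    = (4 * N ^+ 2 * f0 + 2 * N * (M + e) * (2 * f0 + f1)
       + (M + e) ^+ 2 * (f0 + f1 + f2)) / (2 * N) ^+ 2 by field.
  by rewrite pmulr_lge0 // invr_gt0 exprn_gt0 // mulr_gt0.
(* The roots are [(M + d) / (2 * N)] and [(M - d) / (2 * N)]. *)
have := rootP d erefl; have := rootP (- d) (sqrrN d).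
set Fm := (X in 0 <= X -> _).
set Fp := (X in _ -> 0 <= X -> _) => Fm_ge0 Fp_ge0.
have : (M + d) * Fm + (d - M) * Fp = 8 * d * N * (f0 * N + (f0 + f1 + f2) * g0).
  have g0E : 4 * g0 * N = d ^+ 2 - M ^+ 2 by rewrite dd; ring.
  transitivity (8 * d * N ^+ 2 * f0
     + 2 * d * (4 * g0 * N) * (f0 + f1 + f2)); last by ring.
  by rewrite g0E /Fm /Fp; ring.
move=> E; have : 0 <= (M + d) * Fm + (d - M) * Fp.
  by rewrite addr_ge0 // mulr_ge0 //; lra.
by rewrite E pmulr_rge0 // !mulr_gt0.
Qed.

(** * The real inner product and quadratic functions on lines *)

Section RealPart.
Variables (R : realType) (H : lmodType R[i]) (dot : {dot H for Num.conj}).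
Implicit Types (u v w x y : H) (s : R).

(** The real part of a Hermitian form is a symmetric bilinear form over the
reals, and it is all that quadratic functions see of the Hermitian form. *)
Definition redot u v : R := complex.Re (dot u v).

Lemma dotC u v : dot u v = ((dot v u)^*)%C.
Proof. by rewrite (hermC dot) expr0 mul1r. Qed.

Lemma redotC u v : redot u v = redot v u.
Proof. by rewrite /redot dotC; case: (dot v u). Qed.

Lemma redotDl u v w : redot (u + v) w = redot u w + redot v w.
Proof. by rewrite /redot linearDl raddfD. Qed.

Lemma redotNl u w : redot (- u) w = - redot u w.
Proof. by rewrite /redot linearNl raddfN. Qed.

Lemma ReZ s (z : R[i]) : complex.Re (s%:C%C * z) = s * complex.Re z.
Proof. by case: z => p q /=; rewrite mul0r subr0. Qed.

Lemma redotZl s u w : redot (s%:C%C *: u) w = s * redot u w.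
Proof. by rewrite /redot linearZl_LR; exact: ReZ. Qed.

Lemma redotDr u v w : redot w (u + v) = redot w u + redot w v.
Proof. by rewrite !(redotC w) redotDl. Qed.

Lemma redotNr u w : redot w (- u) = - redot w u.
Proof. by rewrite !(redotC w) redotNl. Qed.

Lemma redotZr s u w : redot w (s%:C%C *: u) = s * redot w u.
Proof. by rewrite !(redotC w) redotZl. Qed.

Definition redotE := (redotDl, redotDr, redotNl, redotNr, redotZl, redotZr).

Lemma selfadjoint_real (T : H -> H) x : selfadjoint dot T ->
  dot (T x) x = (redot (T x) x)%:C%C.
Proof.
move=> saT; have := dotC (T x) x; rewrite -saT /redot.
case: (dot (T x) x) => p q /=.
by case=> q_eq; congr (_ +i* _)%C; lra.
Qed.

Variable T : {linear H -> H}.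
Hypothesis saT : selfadjoint dot T.

Lemma redot_sa x y : redot (T x) y = redot (T y) x.
Proof. by rewrite redotC /redot saT. Qed.

Lemma quad_line a x y s : quad dot T a (x + s%:C%C *: y) =
  quad dot T a x + s * (2 * redot (T x + a) y) + s ^+ 2 * redot (T y) y.
Proof.
rewrite /quad -![complex.Re _]/(redot _ _) linearD linearZ /= !redotE.
by rewrite (redot_sa y x); ring.
Qed.

End RealPart.

(** * The S-lemma with equality *)

Section SLemma.
Variables (R : realType) (H : lmodType R[i]) (dot : {dot H for Num.conj}).
Variables (A B : {linear H -> H}).
Hypotheses (saA : selfadjoint dot A) (saB : selfadjoint dot B).
Hypothesis indB : indefinite dot B.
Variables (a b : H) (alpha beta : R).
Implicit Types (h k m y : H) (s : R).
Local Notation f := (quad dot A a).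
Local Notation g := (quad dot B b).
Local Notation "''[' u , v ]" := (redot dot u v).

Lemma indefinite_pos : exists m, 0 < '[B m, m].
Proof.
have [_ /existsNP[m /negP Bm]] := indB; exists m.
by rewrite ltNge; move: Bm; rewrite selfadjoint_real // -lecR.
Qed.

Lemma indefinite_neg : exists m, '[B m, m] < 0.
Proof.
have [/existsNP[m /negP Bm] _] := indB; exists m.
by rewrite ltNge; move: Bm; rewrite selfadjoint_real // -lecR.
Qed.

Lemma quad_gt : exists y, beta < g y.
Proof.
have [m m_gt0] := indefinite_pos.
have [s s_gt] := quadratic_gt (beta - g 0) (2 * '[B 0 + b, m]) m_gt0.
by exists (0 + s%:C%C *: m); rewrite quad_line //; lra.
Qed.

Lemma quad_lt : exists y, g y < beta.
Proof.
have [m m_lt0] := indefinite_neg; rewrite -oppr_gt0 in m_lt0.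
have [s s_gt] := quadratic_gt (g 0 - beta) (- (2 * '[B 0 + b, m])) m_lt0.
by exists (0 + s%:C%C *: m); rewrite quad_line //; lra.
Qed.

Hypothesis f_ge : forall y, g y = beta -> alpha <= f y.

Let cross h k := (f h - alpha) * (beta - g k) + (f k - alpha) * (g h - beta).

(** The condition on [k - h] says that [g] has degree exactly two on the line
through [h] and [k]. *)
Lemma cross_line_ge0 h k : beta < g h -> g k < beta ->
  '[B (k - h), k - h] != 0 -> 0 <= cross h k.
Proof.
move=> gh gk hk; set u := k - h in hk.
have kE : k = h + (1 : R)%:C%C *: u by rewrite scale1r addrC subrK.
have fk : f k = f h + 2 * '[A h + a, u] + '[A u, u].
  by rewrite kE quad_line // expr1n !mul1r.
have gkE : g k = g h + 2 * '[B h + b, u] + '[B u, u].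
  by rewrite kE quad_line // expr1n !mul1r.
have := @quadratic_cross_ge0 _ (f h - alpha) (2 * '[A h + a, u]) '[A u, u]
  (g h - beta) (2 * '[B h + b, u]) '[B u, u].
rewrite /cross fk gkE => cross_ge0.
rewrite (_ : _ + _ = (f h - alpha)
    * - (g h - beta + 2 * '[B h + b, u] + '[B u, u])
  + (f h - alpha + 2 * '[A h + a, u] + '[A u, u]) * (g h - beta)); last by ring.
apply: cross_ge0 => //; [lra|lra|move=> s gs].
have := @f_ge (h + s%:C%C *: u); rewrite !quad_line // => f_ges.
by rewrite [leRHS](_ : _ = f h + s * (2 * '[A h + a, u]) + s ^+ 2 * '[A u, u]
  - alpha) ?subr_ge0 ?f_ges //; lra.
Qed.

(** Dividing by [beta - g k] and [g h - beta], this says that the lower bound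
imposed by [h] on a Lagrange multiplier is at most the upper bound imposed by
[k]. *)
Lemma cross_ge0 h k : beta < g h -> g k < beta -> 0 <= cross h k.
Proof.
move=> gh gk; have [hk0|] := eqVneq '[B (k - h), k - h] 0; last first.
  exact: cross_line_ge0.
(* By the choice of the sign of [m], the form [B] is positive at
   [k - h + s m] for every [s > 0]. *)
have [m m_gt0 hm_ge0] : exists2 m, 0 < '[B m, m] & 0 <= '[B (k - h), m].
  have [m m_gt0] := indefinite_pos; have [?|/ltW hm] := leP 0 '[B (k - h), m].
    by exists m.
  by exists (- m); rewrite ?linearN ?redotE ?opprK // oppr_ge0.
rewrite leNgt; apply/negP => cross_lt0.
(* [c1] and [c2] are the coefficients of [cross h (k + s m)] in [s]. *)
pose c1 := - (f h - alpha) * (2 * '[B k + b, m])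
  + 2 * '[A k + a, m] * (g h - beta).
pose c2 := - (f h - alpha) * '[B m, m] + '[A m, m] * (g h - beta).
have [d d_gt0 d_cross] := quadratic_neg_near0 c1 c2 cross_lt0.
have gk_lt0 : g k - beta < 0 by rewrite subr_lt0.
have [e e_gt0 e_g] :=
  quadratic_neg_near0 (2 * '[B k + b, m]) '[B m, m] gk_lt0.
pose s := Num.min d e / 2.
have s_gt0 : 0 < s by rewrite divr_gt0 // lt_min d_gt0.
have s_lt : s < Num.min d e.
  by rewrite ltr_pdivrMr // ltr_pMr ?ltr1n // lt_min d_gt0.
move: s_lt; rewrite lt_min => /andP[sd se].
have {d_cross} := d_cross s; rewrite s_gt0 sd => /(_ isT).
have {e_g} := e_g s; rewrite s_gt0 se => /(_ isT) gs.
rewrite ltNge => /negP[].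
suff : 0 <= cross h (k + s%:C%C *: m).
  by rewrite /cross !quad_line // /c1 /c2; lra.
apply: cross_line_ge0 => //; first by rewrite quad_line //; lra.
rewrite addrAC; move: (k - h) hk0 hm_ge0 => u hk0 hm_ge0.
rewrite linearD linearZ /= !redotE hk0 (redot_sa saB m).
have : 0 <= s * '[B u, m] by rewrite mulr_ge0 // ltW.
have : 0 < s * (s * '[B m, m]) by rewrite mulr_gt0 // mulr_gt0.
by move=> ? ?; rewrite gt_eqF //; lra.
Qed.

(** Indefiniteness of [B] enters twice: it makes both sides of the constraint
[g = beta] nonempty, so that the supremum below is finite, and it forces
[B <> 0], without which [cross_ge0] could not avoid lines on which [g] is
affine. *)
Lemma S_lemma_equality :
  exists l, forall y, 0 <= (f y - alpha) + l * (g y - beta).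
Proof.
pose r y := (alpha - f y) / (g y - beta).
pose S := [set r y | y in [set y | beta < g y]].
have rS h k : beta < g h -> g k < beta -> r h <= r k.
  move=> gh gk; have := cross_ge0 gh gk; rewrite /cross /r => cross_hk.
  rewrite ler_pdivrMr ?subr_gt0 // mulrAC -[leRHS]opprK -mulrN -mulNr -mulNr.
  rewrite -invrN ler_pdivlMr; lra.
have [h0 gh0] := quad_gt; have [k0 gk0] := quad_lt.
have S_ub : has_ubound S by exists (r k0) => _ [h gh <-]; exact: rS.
exists (sup S) => y; have [gy|gy|gy] := ltgtP (g y) beta.
- have : sup S <= r y.
    by apply: ge_sup; [exists (r h0), h0|move=> _ [h gh <-]; exact: rS].
  by rewrite /r ler_ndivlMr ?subr_lt0 //; lra.
- have : r y <= sup S by apply: ub_le_sup => //; exists y.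
  by rewrite /r ler_pdivrMr ?subr_gt0 //; lra.
- by rewrite gy subrr mulr0 addr0 subr_ge0 f_ge.
Qed.

End SLemma.

(** * Minimizers of quadratic functions *)

Section Minimizers.
Variables (R : realType) (H : lmodType R[i]) (dot : {dot H for Num.conj}).
Implicit Types (x y : H) (l : R).

Lemma redot_eq0 x : redot dot x x = 0 -> x = 0.
Proof.
move=> xx0; apply/eqP; rewrite -(dnorm_eq0 dot).
by rewrite (@selfadjoint_real _ _ dot idfun x) //= xx0.
Qed.

(** Along the line through [x] in the direction [y], the increment of the
quadratic function is [2 s Re <T x + c, y> + s ^+ 2 <T y, y>]; it is
nonnegative for all [s] and [y] exactly when the first term vanishes and the
second is nonnegative. *)
Lemma quad_minP (T : {linear H -> H}) (c x : H) : selfadjoint dot T ->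
  (forall y, quad dot T c x <= quad dot T c y) <->
  possemidef dot T /\ T x = - c.
Proof.
move=> saT; split=> [x_min|[T_ge0 Tx] y].
  have xy_min y : redot dot (T x + c) y = 0 /\ 0 <= redot dot (T y) y.
    have [s|lin0 quad_ge0] := @quadratic0_ge0 _
      (2 * redot dot (T x + c) y) (redot dot (T y) y); last by split=> //; lra.
    by have := x_min (x + s%:C%C *: y); rewrite quad_line // -addrA lerDl.
  split=> [y|]; first by rewrite selfadjoint_real // lecR; case: (xy_min y).
  by apply: subr0_eq; rewrite opprK; apply: redot_eq0; case: (xy_min (T x + c)).
have := T_ge0 (y - x); rewrite selfadjoint_real // lecR => yx_ge0.
rewrite -[y](subrK x) addrC -[y - x]scale1r quad_line //.
by rewrite Tx addNr (redotC _ 0) /redot linear0r /=; lra.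
Qed.

Variables (A B : {linear H -> H}).
Hypotheses (saA : selfadjoint dot A) (saB : selfadjoint dot B).

Lemma selfadjoint_pencil l : selfadjoint dot (A \+ l%:C%C \*: B).
Proof.
move=> x y; rewrite [LHS]linearDl [RHS]linearDr /=.
have -> : dot (A x) y = dot x (A y) := saA x y.
rewrite linearZl_LR linearZr_LR /=.
have -> : dot (B x) y = dot x (B y) := saB x y.
by congr (_ + _ * _); rewrite -[RHS]/((l%:C)^*)%C conjc_real.
Qed.

Lemma quad_pencil l (a b y : H) :
  quad dot (A \+ l%:C%C \*: B) (a + l%:C%C *: b) y =
  quad dot A a y + l * quad dot B b y.
Proof.
by rewrite /quad -![complex.Re _]/(redot _ _ _) /= !redotE; ring.
Qed.

End Minimizers.

Theorem theorem3p3 (R : realType) (H : completeNormedModType R[i])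
    (dot : {dot H for Num.conj})
    (Hnorm : norm_induced dot) (Hsep : separable H)
    (A B : {linear H -> H})
    (bndA : bounded_operator A) (bndB : bounded_operator B)
    (saA : selfadjoint dot A) (saB : selfadjoint dot B)
    (indA : indefinite dot A) (indB : indefinite dot B)
    (beta : R) (a b x : H) :
  minimizers dot A B beta a b x <->
  exists l : R, [/\ I_ge dot A B l,
    A x + l%:C%C *: B x = - (a + l%:C%C *: b) &
    dot (B x) x + 2 * 'Re (dot b x) = beta%:C%C].
Proof.
have feasibleE : dot (B x) x + 2 * 'Re (dot b x) = beta%:C%C <->
    quad dot B b x = beta.
  by rewrite -quadE //; split=> [[]|->].
have minP l := quad_minP (a + l%:C%C *: b) x (selfadjoint_pencil saA saB l).
split=> [[gx x_min]|[l [Al Axl /feasibleE gx]]]; last first.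
  split=> // y gy; have /minP /(_ y) : _ := conj Al Axl.
  by rewrite !quad_pencil gx gy lerD2r.
have [l l_ge] := S_lemma_equality saA saB indB x_min.
have [y|Al Axl] := (minP l).1.
  by rewrite !quad_pencil gx; have := l_ge y; lra.
exists l; split=> //; exact/feasibleE.
Qed.
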